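(* Let $(X,\mathcal F,P)$ be a probability space, let $\mathcal A\subseteq\mathcal F$ be a sub-$\sigma$-algebra, let $v_{\mathcal A}$ be the capacity induced by $\mathcal A$, and let $P_{\mathcal A}$ be the restriction of $P$ to $\mathcal A$. Then: 1. $v_{\mathcal A}(F)=\int_X\mathbf 1_F\,dP_{\mathcal A}$ for all $F\in\mathcal F$; 2. $\int_X f\,dP_{\mathcal A}=\int_X f\,dv_{\mathcal A}$ for all $f\in\mathcal M$.
   Context: $\mathcal M$ is the collection of all nonnegative $\mathcal F$-measurable functions on $X$, and $\mathbf 1_F$ is the characteristic function of $F$. The capacity induced by $\mathcal A$ is $v_{\mathcal A}(F)=\max\{P(A): A\in\mathcal A, A\subseteq F\}$, $F\in\mathcal F$ (the maximum is attained). For $f\in\mathcal M$ (not necessarily $\mathcal A$-measurable) the integral with respect to $P_{\mathcal A}$ is defined by $\int_X f\,dP_{\mathcal A}=\sup\{\sum_{i=1}^N\lambda_i P(A_i):\sum_{i=1}^N\lambda_i\mathbf 1_{A_i}\le f,\ A_i\in\mathcal A,\ \lambda_i\ge0,\ N\in\mathbb N\}\in[0,\infty]$. $\int_X f\,dv_{\mathcal A}$ is the Choquet integral $\int_0^\infty v_{\mathcal A}(\{x: f(x)\ge t\})\,dt\in[0,\infty]$; since $v_{\mathcal A}$ is convex (i.e. $v_{\mathcal A}(F)+v_{\mathcal A}(E)\le v_{\mathcal A}(F\cup E)+v_{\mathcal A}(F\cap E)$), it coincides with the concave integral $\sup\{\sum_{i=1}^N\lambda_i v_{\mathcal A}(F_i):\sum_{i=1}^N\lambda_i\mathbf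 1_{F_i}\le f, F_i\in\mathcal F,\lambda_i\ge0, N\in\mathbb N\}$. *)

(* Defs.v *)
From HB Require Import structures.
From mathcomp Require Import all_boot all_order all_algebra.
From mathcomp Require Import all_classical all_reals all_analysis.

Set Implicit Arguments.
Unset Strict Implicit.
Unset Printing Implicit Defensive.

Import Order.TTheory GRing.Theory Num.Theory.
Import numFieldNormedType.Exports.

Local Open Scope classical_set_scope.
Local Open Scope ring_scope.
Local Open Scope ereal_scope.

Section sub_integral.
Context d (X : measurableType d) (R : realType).

(* A supremum here; [induced_capacity_max] shows that it is a maximum when [A]
   is a sub-sigma-algebra. *)
Definition induced_capacity (P : set X -> \bar R) (A : set (set X))
    (F : set X) : \bar R :=
  ereal_sup [set P B | B in [set B | A B /\ B `<=` F]].

(* The integral of [f] with respect to the restriction of [P] to [A]: only the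
   values of [P] on members of [A] are used, and [f] need not be measurable
   with respect to [A].  The sum may be empty ([N = 0]), with value 0. *)
Definition sub_integral (P : set X -> \bar R) (A : set (set X))
    (f : X -> R) : \bar R :=
  ereal_sup [set s | exists (N : nat) (l : 'I_N -> R) (B : 'I_N -> set X),
    [/\ forall i, A (B i),
        forall i, (0 <= l i)%R,
        forall x, (\sum_(i < N) l i * \1_(B i) x <= f x)%R
      & s = \sum_(i < N) (l i)%:E * P (B i)]].

(* The integrand in [t] is monotone for a monotone [v], so the improper Riemann
   integral of the classical definition is this Lebesgue integral. *)
Definition choquet_integral (v : set X -> \bar R) (f : X -> R) : \bar R :=
  \int[@lebesgue_measure R]_(t in `[0%R, +oo[) v [set x | (t <= f x)%R].

End sub_integral.

Lemma induced_capacity_max d (X : measurableType d) (R : realType)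
    (P : probability X R) (A : set (set X)) (F : set X) :
  sigma_algebra [set: X] A -> A `<=` measurable ->
  exists B, [/\ A B, B `<=` F & P B = induced_capacity P A F].
Proof.
case=> A0 AC AU Am.
have S0 : [set P B | B in [set B | A B /\ B `<=` F]] != set0.
  by apply/set0P; exists (P set0); exists set0 => //; split.
have [u uS ucvg] := ereal_sup_seq S0.
have [B BP] : {B : (set X)^nat &
    forall n, [/\ A (B n), B n `<=` F & P (B n) = u n]}.
  apply: (@choice _ _ (fun n C => [/\ A C, C `<=` F & P C = u n])) => n.
  by have [C [AC' CF] CE] := uS n; exists C.
have AB : A (\bigcup_k B k) by apply: AU => n; case: (BP n).
have BF : \bigcup_k B k `<=` F.
  by move=> x [k _ Bx]; have [_ BkF _] := BP k; exact: BkF.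
exists (\bigcup_k B k); split => //; apply/eqP; rewrite eq_le; apply/andP; split.
  by apply: ereal_sup_ubound; exists (\bigcup_k B k).
rewrite /induced_capacity -(cvg_lim _ ucvg)//; apply: lime_le.
  by apply/cvg_ex; eexists; exact: ucvg.
apply: nearW => n; case: (BP n) => ABn _ <-.
by apply: le_measure; rewrite ?inE; [exact: Am|exact: Am|exact: bigcup_sup].
Qed.

(* Main.v *)
Require Import Defs.
From HB Require Import structures.
From mathcomp Require Import all_boot all_order all_algebra.
From mathcomp Require Import all_classical all_reals all_analysis.
From mathcomp Require Import measurable_realfun.

Set Implicit Arguments.
Unset Strict Implicit.
Unset Printing Implicit Defensive.

Import Order.TTheory GRing.Theory Num.Theory.
Import numFieldNormedType.Exports.

Local Open Scope classical_set_scope.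
Local Open Scope ring_scope.
Local Open Scope ereal_scope.

(** Write [v] for the capacity induced by [A], and [phi t] for the capacity of
    the superlevel set [f >= t].  The function [phi] is nonincreasing with
    values in [0, 1].

    Upper bounds on the integral over the restriction.  A competitor
    [g = sum_i l_i 1_(B i)] is [A]-measurable, so the sets [g > t] belong to [A]
    ([simple_superlevel_in]).  This is what turns values of [P] into lower
    bounds for [v]: if [g <= f] then [g > t] is a member of [A] inside
    [f >= t], hence [P (g > t) <= phi t], and integrating over [t] with the
    layer-cake formula gives [sum_i l_i P (B i) = int g dP <= int f dv]
    ([simple_le_choquet]).  When [f] is an indicator it is quicker to compare
    [g] with the indicator of [g > 0] ([simple_le_indic]).

    Lower bound.  As the capacity is attained, for a step [h > 0] there is
    [B_k] in [A] inside [f >= k h] with [P B_k = phi (k h)].  The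
    combinations [sum_(1 <= k <= n) h 1_(B_k)] lie below the staircase
    [sum_k h 1_(f >= k h)], itself below [f], so they are competitors: the
    right-endpoint Riemann sums of [phi] are at most the integral over the
    restriction.  The left-endpoint sums bound [int phi] from above and exceed
    the right-endpoint ones only by the first term [h phi(0) <= h], and [h] is
    arbitrary ([choquet_le_sub_integral]).  For an indicator the lower bound is
    immediate, since a member of [A] inside [F] is a competitor with one
    term. *)

(** * Monotone functions on the half line and their Riemann sums *)

Section riemann_sums.
Context (R : realType).

(** The sum counts, with weight [h], the thresholds [h, 2h, ..., n h] below [y].
    The induction needs the sharper bound by [min y (n h)]: at a threshold
    below [y] it is [n h], not [y], that leaves room for one more step. *)
Lemma staircase_le (h y : R) (n : nat) : (0 <= h)%R -> (0 <= y)%R ->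
  (\sum_(i < n) h * (i.+1%:R * h <= y)%R%:R <= y)%R.
Proof.
move=> h0 y0.
suff : (\sum_(i < n) h * (i.+1%:R * h <= y)%R%:R <= Num.min y (n%:R * h))%R.
  by rewrite le_min => /andP[].
elim: n => [|n IH]; first by rewrite big_ord0 mul0r le_min lexx y0.
have {IH} /andP[IHy IHn] : (\sum_(i < n) h * (i.+1%:R * h <= y)%R%:R <= y)%R &&
   (\sum_(i < n) h * (i.+1%:R * h <= y)%R%:R <= n%:R * h)%R by rewrite -le_min.
have E : (n.+1%:R * h = n%:R * h + h)%R by rewrite -natr1 mulrDl mul1r.
rewrite big_ord_recr /= le_min; have [ny|ny] := leP (n.+1%:R * h)%R y.
  rewrite mulr1 E lerD2r IHn andbT.
  by rewrite (le_trans _ ny)// E lerD2r.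
by rewrite mulr0 addr0 IHy /= (le_trans IHn)// E lerDl.
Qed.

Lemma itv0y_partition (h : R) : (0 < h)%R ->
  `[0%R, +oo[%classic =
    \bigcup_k `[(k%:R * h)%R, (k.+1%:R * h)%R[%classic :> set R.
Proof.
move=> h0; apply/seteqP; split=> [t /=|t [k _] /=]; rewrite !in_itv/=.
  rewrite andbT => t0; exists (Num.truncn (t / h)) => //=.
  rewrite in_itv/= -ler_pdivlMr// -ltr_pdivrMr//.
  by have := truncn_itv (divr_ge0 t0 (ltW h0)).
by move=> /andP[kt _]; rewrite andbT (le_trans _ kt)// mulr_ge0// ltW.
Qed.

Lemma trivIset_steps (h : R) : (0 < h)%R ->
  trivIset [set: nat] (fun k => `[(k%:R * h)%R, (k.+1%:R * h)%R[%classic : set R).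
Proof.
move=> h0; apply/trivIsetP => i j _ _ ij; apply/seteqP; split=> // t [] /=.
rewrite !in_itv/= => /andP[it ti] /andP[jt tj]; move: ij.
have lt_step (m n : nat) : (m%:R * h <= t)%R ->
    (t < n.+1%:R * h)%R -> (m <= n)%N.
  by move=> mt tn; have := le_lt_trans mt tn; rewrite ltr_pM2r// ltr_nat ltnS.
by rewrite eqn_leq !lt_step.
Qed.

Lemma noninc_emeasurable (D : set R) (phi : R -> \bar R) : measurable D ->
  (forall t, phi t \is a fin_num) ->
  (forall s t, (s <= t)%R -> phi t <= phi s) ->
  measurable_fun D phi.
Proof.
move=> mD fin_phi phi_dec.
have -> : phi = EFin \o (fine \o phi) by apply/funext => t /=; rewrite fineK.
apply/measurable_EFinP; apply: nonincreasing_measurable => // s t st /=.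
by rewrite fine_le//; exact: phi_dec.
Qed.

(** The left-endpoint sum is an upper bound because [phi] is nonincreasing; both
    sides may be infinite. *)
Lemma integral_le_riemann_sum (phi : R -> R) (h : R) : (0 < h)%R ->
  (forall t, 0 <= phi t)%R -> (forall s t, s <= t -> phi t <= phi s)%R ->
  \int[@lebesgue_measure R]_(t in `[0%R, +oo[) (phi t)%:E <=
  \sum_(0 <= k <oo) (h * phi (k%:R * h))%:E.
Proof.
move=> h0 phi0 phi_dec.
have mphi (D : set R) : measurable D -> measurable_fun D (EFin \o phi).
  by move=> mD; apply: noninc_emeasurable.
rewrite (itv0y_partition h0) ge0_integral_bigcup//; last 3 first.
- by apply: mphi; exact: bigcup_measurable.
- by move=> t _; rewrite lee_fin.
- exact: trivIset_steps.
apply: lee_nneseries => [k _ _|k _].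
  by apply: integral_ge0 => t _; rewrite lee_fin.
have -> : (h * phi (k%:R * h))%:E =
  \int[@lebesgue_measure R]_(t in `[(k%:R * h)%R, (k.+1%:R * h)%R[)
    cst (phi (k%:R * h))%:E t.
  rewrite integral_cst//= lebesgue_measure_itv/= lte_fin ltr_pM2r// ltr_nat leqnn.
  by rewrite -EFinD -EFinM -mulrBl -natrB// subSnn mul1r mulrC.
apply: ge0_le_integral => //.
- by move=> t _; rewrite lee_fin.
- exact: mphi.
- by move=> t /=; rewrite in_itv/= => /andP[kt _]; rewrite lee_fin phi_dec.
Qed.

End riemann_sums.

(** * The capacity induced by a sub-sigma-algebra *)

Section capacity.
Context d (X : measurableType d) (R : realType) (P : probability X R).
Context (A : set (set X)).
Hypothesis sA : sigma_algebra [set: X] A.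
Hypothesis Am : A `<=` measurable.

Local Notation v := (induced_capacity P A).

Lemma capacity_ge_sub B F : A B -> B `<=` F -> P B <= v F.
Proof. by move=> AB BF; apply: ereal_sup_ubound; exists B. Qed.

Lemma capacity_ge0 F : 0 <= v F.
Proof.
by rewrite -(measure0 P); apply: capacity_ge_sub; [case: sA|exact: sub0set].
Qed.

Lemma capacity_le1 F : v F <= 1.
Proof.
by apply: ge_ereal_sup => _ [B [AB _] <-]; exact/probability_le1/Am.
Qed.

Lemma capacity_fin_num F : v F \is a fin_num.
Proof.
rewrite ge0_fin_numE; last exact: capacity_ge0.
exact: le_lt_trans (capacity_le1 _) (ltry _).
Qed.

Lemma le_capacity F G : F `<=` G -> v F <= v G.
Proof.
move=> FG; apply: le_ereal_sup => _ [B [AB BF] <-].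
by exists B => //; split=> // x /BF/FG.
Qed.

(** * Simple functions over the sub-sigma-algebra *)

Section simple_function.
Context (N : nat) (l : 'I_N -> R) (B : 'I_N -> set X).
Hypothesis AB : forall i, A (B i).
Hypothesis l0 : forall i, (0 <= l i)%R.

Local Notation g := (fun x => \sum_(i < N) l i * \1_(B i) x)%R.

(** The combination is measurable for the sigma-algebra generated by [A], which
    is [A] itself. *)
Lemma simple_superlevel_in t : A [set x | (t < g x)%R].
Proof.
rewrite -(sigma_algebra_id sA).
have mg : measurable_fun setT (g : g_sigma_algebraType A -> R).
  apply: measurable_sum => i; apply: measurable_funM => //.
  apply: measurable_indic; exact: sub_sigma_algebra.
rewrite -[X in _ X]setTI.
have := mg measurableT `]t, +oo[%classic (measurable_itv _).
by congr (_ _); apply/seteqP; split=> x /=; rewrite in_itv/= andbT.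
Qed.

Lemma simple_measurable : measurable_fun [set: X] g.
Proof.
apply: measurable_sum => i; apply: measurable_funM => //.
by apply: measurable_indic; exact: Am.
Qed.

Lemma simple_ge0 x : (0 <= g x)%R.
Proof. by apply: sumr_ge0 => i _; apply: mulr_ge0. Qed.

Lemma integral_simple : \int[P]_x (g x)%:E = \sum_(i < N) (l i)%:E * P (B i).
Proof.
under eq_integral do rewrite -sumEFin.
rewrite ge0_integral_sum//; last 2 first.
- move=> i; apply/measurable_EFinP; apply: measurable_funM => //.
  by apply: measurable_indic; exact: Am.
- by move=> i x _; rewrite lee_fin mulr_ge0.
apply: eq_bigr => i _; under eq_integral do rewrite EFinM.
rewrite ge0_integralZl//.
- by rewrite integral_indic ?setIT//; exact: Am.
- by apply/measurable_EFinP/measurable_indic; exact: Am.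
- by rewrite lee_fin.
Qed.

Lemma simple_layer_cake : \sum_(i < N) (l i)%:E * P (B i) =
  \int[@lebesgue_measure R]_(t in `[0%R, +oo[) P [set x | (t < g x)%R].
Proof.
rewrite -integral_simple.
pose mg := isMeasurableFun.Build _ _ _ _ _ simple_measurable.
pose G : {RV P >-> R} := HB.pack g mg.
have := @ge0_expectation_ccdf _ _ _ P G simple_ge0.
rewrite expectation_def => ->; apply: eq_integral => t _.
rewrite /ccdf /distribution /pushforward; congr (P _).
by apply/seteqP; split=> x /=; rewrite in_itv/= andbT.
Qed.

(** Below an indicator, the combination is itself at most the indicator of the
    set where it is positive, and that set is a member of [A] inside [F]. *)
Lemma simple_le_indic F : (forall x, g x <= \1_F x)%R ->
  \sum_(i < N) (l i)%:E * P (B i) <= v F.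
Proof.
move=> gF; have gA := simple_superlevel_in 0%R.
apply: (@le_trans _ _ (P [set x | (0 < g x)%R])); last first.
  apply: capacity_ge_sub => // x /= gx; apply: contrapT => Fx.
  by have := lt_le_trans gx (gF x); rewrite indicE memNset// ltxx.
rewrite -integral_simple -[X in _ <= P X]setIT -integral_indic//; last exact: Am.
apply: ge0_le_integral => //.
- by move=> x _; rewrite lee_fin simple_ge0.
- exact/measurable_EFinP/simple_measurable.
- by apply/measurable_EFinP/measurable_indic; exact: Am.
- move=> x _; rewrite lee_fin [leRHS]indicE.
  have [gx|gx] := ltP 0%R (g x).
    by rewrite mem_set//= (le_trans (gF x))// indicE lern1 leq_b1.
  by rewrite (le_trans gx).
Qed.

(** Pointwise comparison in the layer-cake formula: [g > t] is a member of [A]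
    inside [f >= t]. *)
Lemma simple_le_choquet (f : X -> R) : (forall x, g x <= f x)%R ->
  \sum_(i < N) (l i)%:E * P (B i) <= choquet_integral v f.
Proof.
move=> gf; rewrite simple_layer_cake; apply: ge0_le_integral => //.
- apply: noninc_emeasurable => // [t|s t st].
    by apply: fin_num_measure; exact/Am/simple_superlevel_in.
  apply: le_measure; rewrite ?inE; [exact/Am/simple_superlevel_in..|].
  by move=> x /=; exact: le_lt_trans.
- apply: noninc_emeasurable => // [t|s t st]; first exact: capacity_fin_num.
  by apply: le_capacity => x /=; exact: le_trans.
- move=> t _; apply: capacity_ge_sub; first exact: simple_superlevel_in.
  by move=> x /= /ltW /le_trans; apply.
Qed.

End simple_function.

(** * The Choquet integral and the integral over the restriction *)

(** Sets of [A] realizing the capacities of the superlevel sets [f >= k h] turn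
    the Riemann sums of the Choquet integral, up to their first term, into
    competitors for the integral over the restriction. *)
Lemma choquet_le_sub_integral (f : X -> R) : (forall x, 0 <= f x)%R ->
  choquet_integral v f <= sub_integral P A f.
Proof.
move=> f0; apply/lee_addgt0Pr => h h0.
pose phi t := fine (v [set x | (t <= f x)%R]).
have phiE t : (phi t)%:E = v [set x | (t <= f x)%R].
  by rewrite fineK ?capacity_fin_num.
rewrite /choquet_integral; under eq_integral do rewrite -phiE.
have phi0 t : (0 <= phi t)%R by rewrite -lee_fin phiE capacity_ge0.
have phi_dec s t : (s <= t)%R -> (phi t <= phi s)%R.
  move=> st; rewrite -lee_fin !phiE.
  by apply: le_capacity => x /=; exact: le_trans.
have phi_le1 t : (phi t <= 1)%R by rewrite -lee_fin phiE capacity_le1.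
apply: le_trans (integral_le_riemann_sum h0 phi0 phi_dec) _.
have S0 : 0 <= sub_integral P A f.
  apply: ereal_sup_ubound; exists 0%N, (fun=> 0%R), (fun=> set0).
  by split=> [[]|_|x|] //; rewrite big_ord0.
apply: lime_le.
  apply: is_cvg_nneseries => n _ _.
  by rewrite lee_fin mulr_ge0// ltW.
apply: nearW => -[|n]; first by rewrite big_geq// adde_ge0// lee_fin ltW.
(* The term at 0 has no threshold under [f] to pay for it: it is the error [h];
   the remaining [n] terms are the thresholds [h, ..., n h]. *)
rewrite big_nat_recl// addeC; apply: leeD; last first.
  by rewrite lee_fin ler_piMr ?(ltW h0).
have /choice[B BP] (k : nat) : exists B, [/\ A B,
    B `<=` [set x | (k.+1%:R * h <= f x)%R] & P B = (phi (k.+1%:R * h))%:E].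
  by rewrite phiE; exact: induced_capacity_max.
apply: ereal_sup_ubound; exists n, (fun=> h), (fun i => B i); split.
- by move=> i; case: (BP i).
- by move=> _; exact: ltW.
- move=> x; apply: le_trans (staircase_le n (ltW h0) (f0 x)).
  apply: ler_sum => i _; rewrite ler_pM2l// indicE ler_nat.
  case: (boolP (x \in B i)) => // /set_mem xB.
  by case: (BP i) => _ /(_ _ xB) /= ->.
- rewrite big_mkord; apply: eq_bigr => i _.
  by case: (BP i) => _ _ ->; rewrite EFinM.
Qed.

End capacity.

Theorem lemma4 (d : measure_display) (X : measurableType d) (R : realType)
    (P : probability X R) (A : set (set X)) :
  sigma_algebra [set: X] A -> A `<=` measurable ->
  (forall F : set X, measurable F ->
     induced_capacity P A F = sub_integral P A \1_F) /\
  (forall f : X -> R, measurable_fun [set: X] f -> (forall x, (0 <= f x)%R) ->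
     sub_integral P A f = choquet_integral (induced_capacity P A) f).
Proof.
move=> sA Am; split=> [F mF|f mf f0]; apply/eqP; rewrite eq_le; apply/andP; split.
- apply: ge_ereal_sup => _ [B [AB BF] <-].
  apply: ereal_sup_ubound; exists 1%N, (fun=> 1%R), (fun=> B); split=> //.
  + move=> x; rewrite big_ord1 mul1r !indicE ler_nat.
    by case: (boolP (x \in B)) => // /set_mem/BF xF; rewrite mem_set.
  + by rewrite big_ord1 mul1e.
- apply: ge_ereal_sup => _ [N [l [B [AB l0 BF ->]]]].
  exact: simple_le_indic.
- apply: ge_ereal_sup => _ [N [l [B [AB l0 Bf ->]]]].
  exact: simple_le_choquet.
- exact: choquet_le_sub_integral.
Qed.
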